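(* Let $p$ be an odd prime and $\mathbf{k}$ a field of characteristic $p$. Then, in $\mathbf{k}(f,g,\alpha_1,\alpha_2,t)$, $$s_0(\mathcal{I}_p)=\mathcal{I}_p,\quad s_1(\mathcal{I}_p)=\mathcal{I}_p+t^p(\alpha_1^p-\alpha_1),\quad s_2(\mathcal{I}_p)=\mathcal{I}_p-t^p(\alpha_2^p-\alpha_2),\quad \pi(\mathcal{I}_p)=\mathcal{I}_p-t^p(\alpha_2^p-\alpha_2).$$ For $p=2$ the same formulas hold with $t^2$ replaced by $1+t^2$ on the right-hand sides, i.e. $s_0(\mathcal{I}_2)=\mathcal{I}_2$, $s_1(\mathcal{I}_2)=\mathcal{I}_2+(1+t^2)(\alpha_1^2-\alpha_1)$, $s_2(\mathcal{I}_2)=\mathcal{I}_2-(1+t^2)(\alpha_2^2-\alpha_2)$, $\pi(\mathcal{I}_2)=\mathcal{I}_2-(1+t^2)(\alpha_2^2-\alpha_2)$.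
   Context: On $\mathbf{k}(f,g,\alpha_1,\alpha_2,t)$ let $s_0,s_1,s_2,\pi$ be the $\mathbf{k}$-linear field automorphisms fixing $t$ and acting by: $s_0:\ \alpha_1\mapsto 1-\alpha_2,\ \alpha_2\mapsto1-\alpha_1,\ f\mapsto f+\frac{\alpha_1+\alpha_2-1}{f-g+t},\ g\mapsto g+\frac{\alpha_1+\alpha_2-1}{f-g+t}$; $s_1:\ \alpha_1\mapsto-\alpha_1,\ \alpha_2\mapsto\alpha_1+\alpha_2,\ f\mapsto f,\ g\mapsto g-\frac{\alpha_1}{f}$; $s_2:\ \alpha_1\mapsto\alpha_1+\alpha_2,\ \alpha_2\mapsto-\alpha_2,\ f\mapsto f+\frac{\alpha_2}{g},\ g\mapsto g$; $\pi:\ \alpha_1\mapsto\alpha_2,\ \alpha_2\mapsto1-\alpha_1-\alpha_2,\ f\mapsto -g,\ g\mapsto f-g+t$. Define the $2\times2$ matrix polynomial in $z$ $$A(z)=\begin{bmatrix}w&0\\0&1\end{bmatrix}\begin{bmatrix}1&0\\ f-tfg-tz&1\end{bmatrix}\begin{bmatrix}g&1\\ z+\alpha_2&0\end{bmatrix}\begin{bmatrix}-f&1\\ z&0\end{bmatrix}\begin{bmatrix}tz-g+tfg&1\\ z-\alpha_1&0\end{bmatrix}\begin{bmatrix}w^{-1}&0\\0&1\end{bmatrix}$$ and $\mathcal{I}_p:=\operatorname{Tr}[A(p-1)\cdots A(1)A(0)]$ computed in characteristic $p$, an element of $\mathbb{F}_p[f,g,\alpha_1,\alpha_2,t]$ independent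 of $w$, viewed in $\mathbf{k}(f,g,\alpha_1,\alpha_2,t)$. *)

(* Defs.v *)
From HB Require Import structures.
From mathcomp Require Import all_boot all_order all_algebra.
From mathcomp Require Import fraction.
From mathcomp Require Import mpoly.
Set Implicit Arguments. Unset Strict Implicit. Unset Printing Implicit Defensive.
Import Order.TTheory GRing.Theory Num.Theory.
Local Open Scope ring_scope.

Definition RF (k : fieldType) := {fraction {mpoly k[5]}}.

Definition rvar (k : fieldType) (i : 'I_5) : RF k := tofrac ('X_i : {mpoly k[5]}).
Definition vf (k : fieldType) : RF k := rvar k 0.
Definition vg (k : fieldType) : RF k := rvar k 1.
Definition va1 (k : fieldType) : RF k := rvar k 2.
Definition va2 (k : fieldType) : RF k := rvar k 3.
Definition vt (k : fieldType) : RF k := rvar k 4.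

Definition mx2 (R : comUnitRingType) (a b c d : R) : 'M[R]_2 :=
  \matrix_(i < 2, j < 2)
     (if i == 0 :> nat then (if j == 0 :> nat then a else b)
      else (if j == 0 :> nat then c else d)).

Definition Amat (R : comUnitRingType) (w f g a1 a2 t z : R) : 'M[R]_2 :=
  (mx2 w 0 0 1) *m
  (mx2 (1) (0) (f - t * f * g - t * z) (1)) *m
  (mx2 (g) (1) (z + a2) (0)) *m
  (mx2 (- f) (1) (z) (0)) *m
  (mx2 (t * z - g + t * f * g) (1) (z - a1) (0)) *m
  (mx2 w^-1 0 0 1).

(* Tr[A(p-1) ... A(1) A(0)] computed in R (of characteristic p), as a
   polynomial expression in f, g, alpha1, alpha2, t.  The value is
   independent of w (conjugation invariance of the trace); we take w = 1. *)
Definition Iexpr (R : comUnitRingType) (p : nat) (f g a1 a2 t : R) : R :=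
  \tr (\prod_(i <- rev (iota 0 p)) Amat 1 f g a1 a2 t i%:R).

Definition Ip (k : fieldType) (p : nat) : RF k :=
  Iexpr p (vf k) (vg k) (va1 k) (va2 k) (vt k).

(* Applying a k-algebra automorphism sigma (fixing t) to the polynomial I_p
   amounts to substituting sigma(f), sigma(g), sigma(alpha1), sigma(alpha2)
   for f, g, alpha1, alpha2 in the polynomial expression of I_p. *)
Definition applyI (k : fieldType) (p : nat) (sf sg sa1 sa2 : RF k) : RF k :=
  Iexpr p sf sg sa1 sa2 (vt k).

Section Auts.
Variable k : fieldType.
Local Notation f := (vf k). Local Notation g := (vg k).
Local Notation a1 := (va1 k). Local Notation a2 := (va2 k).
Local Notation t := (vt k).

Definition s0I (p : nat) : RF k :=
  applyI p (f + (a1 + a2 - 1) / (f - g + t)) (g + (a1 + a2 - 1) / (f - g + t))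
           (1 - a2) (1 - a1).
Definition s1I (p : nat) : RF k := applyI p f (g - a1 / f) (- a1) (a1 + a2).
Definition s2I (p : nat) : RF k := applyI p (f + a2 / g) g (a1 + a2) (- a2).
Definition piI (p : nat) : RF k := applyI p (- g) (f - g + t) a2 (1 - a1 - a2).
End Auts.

(* Main.v *)
Require Import Defs.
From HB Require Import structures.
From mathcomp Require Import all_boot all_order all_algebra.
From mathcomp Require Import fraction.
From mathcomp Require Import mpoly.
From mathcomp Require Import ring zify.
Import GRing.Theory.
Set Implicit Arguments. Unset Strict Implicit. Unset Printing Implicit Defensive.
Local Open Scope ring_scope.

(* Up to cyclic rotation under the trace, A(p-1) ... A(0) is a 3p-periodic
   product of matrices L(x, y) = [x 1; y 0], with x running through -f, g,
   h = f - g + t and y through z + i, z + i + a2, z + i + 1 - a1.  Call its trace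
   T(z), so that I_p = T(0).  Each s_j exchanges two neighbouring y's, which
   leaves a product of three consecutive factors unchanged, and pi rotates the
   product; after a translation of z the transformed trace is again T, so that
   s_0, s_1, s_2, pi send I_p to T(0), T(a1), T(-a2), T(-a2).
   It remains to show T(z) = T(0) + t^p (z^p - z) for p odd.  Since
   T(z + 1) = T(z), it suffices that T - t^p z^p has degree < p.  Let B be the
   product of three factors and expand the trace over closed walks of length p
   on {0, 1}.  A nonconstant walk has p distinct rotations, and together they
   contribute sum_k psi(z + k), where deg psi <= 3p/2; in characteristic p such
   a sum has degree at most deg psi - (p - 1) < p.  The two constant walks give
   prod_k B_00(z + k) + prod_k B_11(z + k), with leading coefficient
   (h - f)^p + g^p = t^p.
   To avoid choosing representatives of the rotation classes, the walks are
   counted by their number of visits to 1, recorded by a marking variable X: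
   differentiating in X marks one visit, which can be rotated to time 0. *)

(** * Reversed ranges, 2 by 2 matrices, and rotation of products under the trace *)

Lemma revD_iota m n k :
  rev (iota m (n + k)) = rev (iota (m + n) k) ++ rev (iota m n).
Proof. by rewrite iotaD rev_cat. Qed.

Lemma rev_iotaS m n : rev (iota m n.+1) = (m + n)%N :: rev (iota m n).
Proof. by rewrite -addn1 revD_iota. Qed.

Lemma ord2_case (P : 'I_2 -> Prop) : P 0 -> P 1 -> forall i, P i.
Proof.
move=> P0 P1 i; have [->|/eqP ne0] := eqVneq i 0 => //.
have -> // : i = 1.
by apply/val_inj; case: i ne0 => [[|[|?]] ?] //= H; case: H; apply/val_inj.
Qed.

Lemma mx2P (R : comUnitRingType) (M N : 'M[R]_2) :
  M 0 0 = N 0 0 -> M 0 1 = N 0 1 -> M 1 0 = N 1 0 -> M 1 1 = N 1 1 -> M = N.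
Proof. by move=> *; apply/matrixP; apply: ord2_case; apply: ord2_case. Qed.

Lemma mx2_mul (R : comUnitRingType) (a b c d a' b' c' d' : R) :
  mx2 a b c d * mx2 a' b' c' d' =
  mx2 (a * a' + b * c') (a * b' + b * d') (c * a' + d * c') (c * b' + d * d').
Proof. by apply: mx2P; rewrite mxE !big_ord_recl big_ord0 addr0 !mxE. Qed.

Lemma mx2_tr (R : comUnitRingType) (a b c d : R) : \tr (mx2 a b c d) = a + d.
Proof. by rewrite /mxtrace !big_ord_recl big_ord0 addr0 !mxE. Qed.

Lemma mx2_1 (R : comUnitRingType) : mx2 1 0 0 1 = 1 :> 'M[R]_2.
Proof. by apply: mx2P; rewrite !mxE. Qed.

Lemma map_mx2 (R S : comUnitRingType) (f : {rmorphism R -> S}) a b c d :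
  map_mx f (mx2 a b c d) = mx2 (f a) (f b) (f c) (f d).
Proof. by apply: mx2P; rewrite !mxE. Qed.

Lemma prod_rot (R : pzRingType) (X Y : nat -> R) n :
  Y n * \prod_(i <- rev (iota 0 n)) (X i * Y i) =
  \prod_(i <- rev (iota 0 n)) (Y i.+1 * X i) * Y 0%N.
Proof.
elim: n => [|n IH]; first by rewrite !big_nil mulr1 mul1r.
by rewrite !rev_iotaS !big_cons add0n -!mulrA IH !mulrA.
Qed.

(** Cyclicity of the trace carries the rightmost factor [Y 0] to the front, where it serves as
    [Y n]. *)
Lemma mxtrace_prod_rot (R : comUnitRingType) (X Y : nat -> 'M[R]_2) n :
  Y n = Y 0%N ->
  \tr (\prod_(i <- rev (iota 0 n)) (X i * Y i)) =
  \tr (\prod_(i <- rev (iota 0 n)) (Y i.+1 * X i)).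
Proof.
case: n => [|n] Yn; first by rewrite !big_nil.
rewrite !rev_iotaS !big_cons add0n -mulrA prod_rot Yn mulrA [LHS]mxtrace_mulC.
by rewrite !mulmxE mulrA.
Qed.

(** * The periodic product and its rotation and exchange symmetries *)

Definition lmx (R : comUnitRingType) (x y : R) : 'M[R]_2 := mx2 x 1 y 0.

Definition cell (R : comUnitRingType) (x0 x1 x2 y0 y1 y2 : R) (i : nat) :=
  lmx x2 (y2 + i%:R) * lmx x1 (y1 + i%:R) * lmx x0 (y0 + i%:R).

Definition theta (R : comUnitRingType) (p : nat) (x0 x1 x2 y0 y1 y2 : R) : R :=
  \tr (\prod_(i <- rev (iota 0 p)) cell x0 x1 x2 y0 y1 y2 i).

Lemma theta_rmorph (R S : comUnitRingType) (f : {rmorphism R -> S}) p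
    (x0 x1 x2 y0 y1 y2 : R) :
  f (theta p x0 x1 x2 y0 y1 y2) =
  theta p (f x0) (f x1) (f x2) (f y0) (f y1) (f y2).
Proof.
rewrite /theta -trace_map_mx rmorph_prod; congr (\tr _); apply: eq_bigr => i _.
by rewrite /cell /lmx !rmorphM /= !map_mx2 !rmorphD !rmorph_nat rmorph0 rmorph1.
Qed.

(** The rightmost factor of cell [i.+1] joins cell [i] as its leftmost factor, hence the 1 added to
    [y0]. *)
Lemma theta_rot (R : comUnitRingType) p (x0 x1 x2 y0 y1 y2 : R) :
  p%:R = 0 :> R ->
  theta p x0 x1 x2 y0 y1 y2 = theta p x1 x2 x0 y1 y2 (y0 + 1).
Proof.
move=> p0; rewrite /theta /cell.
rewrite (@mxtrace_prod_rot R (fun i => lmx x2 (y2 + i%:R) * lmx x1 (y1 + i%:R))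
          (fun i => lmx x0 (y0 + i%:R))) ?p0 //.
congr (\tr _); apply: eq_bigr => i _.
by rewrite mulrA -addrA -[1 + _]/(1%:R + i%:R) -natrD add1n.
Qed.

(** Both x1 x0 + y0 and x2 x1 + y1 survive the exchange because x1 e = y0 - y1, and they determine
    how the entries change. *)
Lemma cell_swap (R : comUnitRingType) (x0 x1 x2 y0 y1 y2 : R) i e :
  x1 * e = y0 - y1 ->
  cell (x0 + e) x1 (x2 - e) y1 y0 y2 i = cell x0 x1 x2 y0 y1 y2 i.
Proof.
move=> he; rewrite /cell /lmx !mx2_mul.
have -> : y0 = x1 * e + y1 by rewrite he subrK.
congr mx2; ring.
Qed.

Lemma theta_swap (R : comUnitRingType) p (x0 x1 x2 y0 y1 y2 e : R) :
  x1 * e = y0 - y1 ->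
  theta p (x0 + e) x1 (x2 - e) y1 y0 y2 = theta p x0 x1 x2 y0 y1 y2.
Proof. by move=> he; rewrite /theta; under eq_bigr do rewrite cell_swap//. Qed.

Lemma Iexpr_theta (R : comUnitRingType) p (f g a1 a2 t : R) :
  p%:R = 0 :> R ->
  Iexpr p f g a1 a2 t = theta p (- f) g (f - g + t) 0 a2 (1 - a1).
Proof.
(* The last factor of A(i + 1) times the first factor of A(i) is
   L(f - g + t, i + 1 - a1). *)
move=> p0; rewrite /Iexpr /Amat /theta.
under eq_bigr do rewrite invr1 mx2_1 !mulmxE mul1r mulr1.
rewrite (@mxtrace_prod_rot R _ (fun i => mx2 (t * i%:R - g + t * f * g) 1 (i%:R - a1) 0))
  ?p0 //.
congr (\tr _); apply: eq_bigr => i _.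
rewrite !mulrA /cell /lmx !mx2_mul -natr1.
congr mx2; ring.
Qed.

Arguments theta_rot {R p x0 x1 x2 y0 y1 y2} p0.
Arguments theta_swap {R p x0 x1 x2 y0 y1 y2 e} he.

(** * The four transformations as translates of T *)

Section Transformations.
Variables (F : fieldType) (p : nat).
Hypothesis p0 : p%:R = 0 :> F.
Implicit Types f g t : F.

Lemma Iexpr_s0 f g a1 a2 t : f - g + t != 0 ->
  Iexpr p (f + (a1 + a2 - 1) / (f - g + t)) (g + (a1 + a2 - 1) / (f - g + t))
    (1 - a2) (1 - a1) t = theta p (- f) g (f - g + t) 0 a2 (1 - a1).
Proof.
move=> h0; rewrite Iexpr_theta //.
set e := _ / _.
rewrite [RHS](theta_rot p0) -[RHS](theta_swap (e := e)); last first.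
  by rewrite /e mulrC divfK //; ring.
(* One rotation puts the pair to be exchanged, [y1] and [y2], in the first two places, with f - g +
   t as the middle x. *)
rewrite [LHS](theta_rot p0); congr (theta p _ _ _ _ _ _); ring.
Qed.

Lemma Iexpr_s1 f g a1 a2 t : f != 0 ->
  Iexpr p f (g - a1 / f) (- a1) (a1 + a2) t =
  theta p (- f) g (f - g + t) a1 (a1 + a2) (a1 + (1 - a1)).
Proof.
move=> f0; rewrite Iexpr_theta //; set e := a1 / f.
(* Two rotations make -f the middle x, between [y2] and [y0 + 1]. *)
rewrite [in LHS](theta_rot p0) [in LHS](theta_rot p0).
rewrite [in RHS](theta_rot p0) [in RHS](theta_rot p0).
rewrite -[RHS](theta_swap (e := e)).
  congr (theta p _ _ _ _ _ _); ring.
rewrite /e mulNr mulrC divfK //; ring.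
Qed.

Lemma Iexpr_s2 f g a1 a2 t : g != 0 ->
  Iexpr p (f + a2 / g) g (a1 + a2) (- a2) t =
  theta p (- f) g (f - g + t) (- a2) (- a2 + a2) (- a2 + (1 - a1)).
Proof.
move=> g0; rewrite Iexpr_theta //; set e := a2 / g.
rewrite -[RHS](theta_swap (e := - e)).
  congr (theta p _ _ _ _ _ _); ring.
rewrite /e mulrN mulrC divfK //; ring.
Qed.

Lemma Iexpr_pi f g a1 a2 t :
  Iexpr p (- g) (f - g + t) a2 (1 - a1 - a2) t =
  theta p (- f) g (f - g + t) (- a2) (- a2 + a2) (- a2 + (1 - a1)).
Proof.
rewrite Iexpr_theta // [RHS](theta_rot p0).
congr (theta p _ _ _ _ _ _); ring.
Qed.
End Transformations.

(** * Unit shifts of polynomials in characteristic p *)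

Section ShiftPoly.
Variables (F : fieldType) (p : nat).
Hypothesis charFp : p \in [pchar F].
Implicit Types q : {poly F}.

(** The difference q - q(0) vanishes at the p distinct elements 0, ..., p - 1 of the prime field,
    too many for its degree. *)
Lemma shift_invariant_const q : q \Po ('X + 1) = q -> (size q <= p)%N ->
  q = q.[0]%:P.
Proof.
move=> qX sq; apply/eqP; rewrite -subr_eq0.
have qn n : q.[n%:R] = q.[0].
  elim: n => [|n IH] //; rewrite -IH -{2}qX horner_comp.
  by rewrite hornerD hornerX hornerC natr1.
apply/negPn/negP => nz.
have := max_poly_roots nz (rs := [seq i%:R | i <- iota 0 p]).
have -> : all (root (q - q.[0]%:P)) [seq i%:R | i <- iota 0 p].
  by apply/allP => x /mapP[i _ ->]; rewrite rootE !hornerE qn subrr.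
have -> : uniq [seq (i%:R : F) | i <- iota 0 p].
  rewrite map_inj_in_uniq ?iota_uniq // => i j.
  rewrite !mem_iota !add0n /= => ip jp e.
  wlog le_ij : i j ip jp e / (i <= j)%N.
    by move=> H; case: (leqP i j) => [/H|/ltnW /H ->] //; apply.
  have : (p %| j - i)%N by rewrite (dvdn_pcharf charFp) natrB // e subrr.
  by case: (posnP (j - i)%N) => [|lt /(dvdn_leq lt)]; lia.
move=> /(_ isT isT); rewrite size_map size_iota ltnNge => /negP; apply.
apply: leq_trans (size_polyD _ _) _; rewrite size_polyN geq_max sq /=.
by rewrite (leq_trans (size_polyC_leq1 _)) // prime_gt0 ?(pcharf_prime charFp).
Qed.

(** Telescoping (k + 1)^(m + 1) - k^(m + 1) leaves, by induction on m, only m + 1 times the sum, and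
    m + 1 is invertible. *)
Lemma sum_exp_pchar m : (m.+1 < p)%N -> \sum_(0 <= k < p) (k%:R : F) ^+ m = 0.
Proof.
elim/ltn_ind: m => m IH mp.
have: \sum_(0 <= k < p) ((k.+1%:R : F) ^+ m.+1 - k%:R ^+ m.+1) = 0.
  by rewrite telescope_sumr // (pcharf0 charFp) subrr.
have -> : \sum_(0 <= k < p) ((k.+1%:R : F) ^+ m.+1 - k%:R ^+ m.+1) =
   \sum_(0 <= k < p) \sum_(j < m.+1) (k%:R : F) ^+ j *+ 'C(m.+1, j).
  apply: eq_bigr => k _; rewrite -natr1 [_ + 1]addrC exprDn big_ord_recr /=.
  rewrite subnn binn expr0 mul1r mulr1n addrK.
  by apply: eq_bigr => j _; rewrite expr1n mul1r.
rewrite exchange_big big_ord_recr /= big1 ?add0r => [|j _]; last first.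
  by rewrite sumrMnl IH ?mul0rn // (leq_trans _ mp) // !ltnS ltnW.
rewrite sumrMnl binSn => /eqP; rewrite -mulr_natr mulf_eq0 => /orP[/eqP//|].
by rewrite -(dvdn_pcharf charFp) gtnNdvd.
Qed.

(** In the binomial expansion z^(n - i) comes with the power sum of the k^i, which vanishes for i <
    p - 1. The subtraction is truncated: a short q has sum 0. *)
Lemma size_sum_shift q :
  (size (\sum_(0 <= k < p) (q \Po ('X + (k%:R)%:P)))%R <= size q - p.-1)%N.
Proof.
have -> : \sum_(0 <= k < p) (q \Po ('X + (k%:R)%:P)) =
  \sum_(n < size q) q`_n *: \sum_(i < n.+1)
     (\sum_(0 <= k < p) (k%:R : F) ^+ i) *: 'X^(n - i) *+ 'C(n, i).
  under eq_bigr do rewrite comp_polyE.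
  rewrite exchange_big; apply: eq_bigr => n _ /=; rewrite -scaler_sumr.
  congr (_ *: _).
  transitivity (\sum_(0 <= k < p) \sum_(i < n.+1)
      ((k%:R : F)%:P ^+ i * 'X^(n - i) *+ 'C(n, i))).
    by apply: eq_bigr => k _; rewrite exprDn; apply: eq_bigr => i _; rewrite mulrC.
  rewrite exchange_big; apply: eq_bigr => i _ /=.
  rewrite sumrMnl scaler_suml; congr (_ *+ _); apply: eq_bigr => k _.
  by rewrite -rmorphXn /= mul_polyC.
apply: leq_trans (size_sum _ _ _) _; apply/bigmax_leqP => n _.
apply: leq_trans (size_scale_leq _ _) _.
apply: leq_trans (size_sum _ _ _) _; apply/bigmax_leqP => i _.
have [ip|pi] := ltnP i.+1 p.
  by rewrite sum_exp_pchar // scale0r mul0rn size_poly0.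
rewrite -scaler_nat; apply: leq_trans (size_scale_leq _ _) _.
apply: leq_trans (size_scale_leq _ _) _; rewrite size_polyXn.
have := ltn_ord n; have := ltn_ord i; lia.
Qed.
End ShiftPoly.

(** * Products with a marking variable, and traces over closed walks *)

Section Marking.
Variables (R : nzRingType) (U V : nat -> R).
Let G i : {poly R} := (U i)%:P + (V i)%:P * 'X.
Let P n := \prod_(i <- rev (iota 0 n)) G i.

Lemma coef0_prod_marked n : (P n)`_0 = \prod_(i <- rev (iota 0 n)) U i.
Proof.
rewrite /P; elim: n => [|n IH]; first by rewrite !big_nil coef1.
by rewrite rev_iotaS !big_cons coef0M IH /G coefD coefMX !coefC /= addr0.
Qed.

Lemma size_prod_marked n : (size (P n) <= n.+1)%N.
Proof.
rewrite /P; elim: n => [|n IH]; first by rewrite big_nil size_poly1.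
rewrite rev_iotaS big_cons; apply: leq_trans (size_polyMleq _ _) _.
rewrite add0n; suff: (size (G n) <= 2)%N by lia.
apply: leq_trans (size_polyD _ _) _; rewrite geq_max.
rewrite (leq_trans (size_polyC_leq1 _)) //=.
apply: leq_trans (size_polyMleq _ _) _; rewrite size_polyX.
by have := size_polyC_leq1 (V n); lia.
Qed.

Lemma coefn_prod_marked n : (P n)`_n = \prod_(i <- rev (iota 0 n)) V i.
Proof.
elim: n => [|n IH]; first by rewrite /P !big_nil coef1.
rewrite [P _]/P !rev_iotaS !big_cons add0n -/(P n) /G mulrDl coefD coefCM.
rewrite (nth_default _ (size_prod_marked n)) mulr0 add0r -mulrA coefCM.
by rewrite -commr_polyX coefMX /= IH.
Qed.

(** Evaluation at X = 1; it is multiplicative over a noncommutative [R] because 1 is central. *)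
Lemma sum_coef_prod_marked n :
  \sum_(j < n.+1) (P n)`_j = \prod_(i <- rev (iota 0 n)) (U i + V i).
Proof.
transitivity (P n).[1].
  rewrite (horner_coef_wide _ (size_prod_marked n)); apply: eq_bigr => j _.
  by rewrite expr1n mulr1.
rewrite /P; elim: n => [|n IH]; first by rewrite !big_nil hornerC.
rewrite rev_iotaS !big_cons hornerM_comm; last by rewrite /comm_poly mulr1 mul1r.
by rewrite IH /G hornerD hornerMX !hornerC mulr1.
Qed.

(** Leibniz rule with the order of factors kept: each term singles out one marked visit, at time
    k. *)
Lemma deriv_prod_marked n : (P n)^`() = \sum_(0 <= k < n)
  (\prod_(i <- rev (iota k.+1 (n - k.+1))) G i) * (V k)%:P *
  (\prod_(i <- rev (iota 0 k)) G i).
Proof.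
elim: n => [|n IH]; first by rewrite /P big_nil big_geq // derivE.
rewrite [P _]/P rev_iotaS big_cons add0n -/(P n) derivM IH.
rewrite big_nat_recr //= subnn big_nil mul1r addrC; congr (_ + _).
  by rewrite derivD derivC add0r derivM derivC mul0r add0r derivX mulr1.
rewrite big_distrr /=; apply: eq_big_nat => k /= kn.
rewrite subSn ?rev_iotaS ?big_cons ?mulrA; last by lia.
by rewrite subnKC //; lia.
Qed.
End Marking.

(** The marking variable is central, so cyclicity of the trace holds coefficient by coefficient. *)
Lemma mxtrace_coefMC (R : comNzRingType) n (A B : {poly 'M[R]_n.+1}) j :
  \tr (A * B)`_j = \tr (B * A)`_j.
Proof.
rewrite coefM coefMr !raddf_sum /=.
by apply: eq_bigr => i _; rewrite -mulmxE mxtrace_mulC.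
Qed.

Lemma mul_delta_diag (R : comNzRingType) n (A : 'M[R]_n) i a b :
  (A *m delta_mx i i) a b = A a i * (b == i)%:R.
Proof.
rewrite mxE (bigD1 i) //= big1 ?addr0 => [|c /negPf ci]; rewrite mxE ?eqxx //=.
by rewrite ci mulr0.
Qed.

(** The projections leave only the constant walk at i. The product is nonempty, since the trace of
    an empty one is the dimension. *)
Lemma tr_prod_delta_diag (R : comNzRingType) m (A : nat -> 'M[R]_m.+1) i n :
  \tr (\prod_(k <- rev (iota 0 n.+1)) (A k *m delta_mx i i)) =
  \prod_(k <- rev (iota 0 n.+1)) A k i i.
Proof.
set X := (X in \tr X); suff E a b : X a b =
    A n a i * (\prod_(k <- rev (iota 0 n)) A k i i) * (b == i)%:R.
  rewrite /mxtrace (bigD1 i) // big1 ?addr0 => [|c /negPf ci].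
    by rewrite [LHS]addr0 E eqxx mulr1 rev_iotaS big_cons add0n.
  by rewrite E ci mulr0.
rewrite {}/X; elim: n a b => [|n IH] a b.
  by rewrite [rev _]/= big_seq1 big_nil mulr1 mul_delta_diag.
rewrite rev_iotaS big_cons add0n -mulmxE mxE (bigD1 i) //= big1 ?addr0.
  by rewrite mul_delta_diag IH eqxx mulr1 rev_iotaS big_cons !mulrA.
by move=> c /negPf ci; rewrite mul_delta_diag ci mulr0 mul0r.
Qed.

(** * Half-integral degree bounds for matrix products *)

Section Weight.
Variable F : fieldType.
Implicit Types A B : 'M[{poly F}]_2.

(* Twice the degree of the (i, j) entry is at most d + i - j, which is a bound
   d / 2 on the degree after conjugation by diag(1, z^(1/2)).  Every L(x, y)
   has weight 1.  The constant 2 accounts for size = degree + 1. *)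
Definition weight_le d A :=
  forall i j : 'I_2, ((size (A i j)).*2 + j <= d + i + 2)%N.

Lemma weight_le0 d : weight_le d 0.
Proof. by move=> i j; rewrite mxE size_poly0; have := ltn_ord j; lia. Qed.

Lemma weight_leD d A B : weight_le d A -> weight_le d B -> weight_le d (A + B).
Proof.
move=> wA wB i j; have := wA i j; have := wB i j; rewrite mxE.
move: (size_polyD (A i j) (B i j)); set s := size _; lia.
Qed.

Lemma weight_le_sum (I : Type) (r : seq I) (P : pred I) (f : I -> 'M[{poly F}]_2) d :
  (forall i, weight_le d (f i)) -> weight_le d (\sum_(i <- r | P i) f i).
Proof.
move=> w; apply: big_ind => // [|A B]; [exact: weight_le0 | exact: weight_leD].
Qed.

Lemma weight_leM d e A B : weight_le d A -> weight_le e B ->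
  weight_le (d + e) (A * B).
Proof.
move=> wA wB i j; rewrite -mulmxE mxE.
have H k : ((size (A i k * B k j)%R).*2 + j <= d + e + i + 2)%N.
  (* The index k cancels between the two bounds; zero entries are set apart because [size_mul]
     requires nonzero factors. *)
  have [->|nzA] := eqVneq (A i k) 0.
    by rewrite mul0r size_poly0; have := ltn_ord j; lia.
  have [->|nzB] := eqVneq (B k j) 0.
    by rewrite mulr0 size_poly0; have := ltn_ord j; lia.
  rewrite size_mul //; move: (wA i k) (wB k j) nzA nzB; rewrite -!size_poly_gt0.
  by move: (size _) (size _) => m n; lia.
apply: (big_ind (fun q : {poly F} => (size q).*2 + j <= d + e + i + 2)%N).
- by rewrite size_poly0; have := ltn_ord j; lia.
- by move=> q r; move: (size_polyD q r); set s := size _; lia.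
- by move=> k _; apply: H.
Qed.

Lemma weight_le_delta i : weight_le 0 (delta_mx i i).
Proof.
move=> a b; rewrite mxE; case: andP => [[/eqP-> /eqP->]|_] /=.
  by rewrite mulr1n size_poly1; lia.
by rewrite mulr0n size_poly0; have := ltn_ord b; lia.
Qed.

Lemma weight_le1 : weight_le 0 1.
Proof.
move=> a b; rewrite mxE; case: eqP => [->|_].
  by rewrite mulr1n size_poly1; lia.
by rewrite mulr0n size_poly0; have := ltn_ord b; lia.
Qed.

Lemma weight_le_shift d A (c : F) : weight_le d A ->
  weight_le d (map_mx (comp_poly ('X + c%:P)) A).
Proof. by move=> wA i j; rewrite mxE size_comp_poly2 ?size_XaddC. Qed.

Lemma size_trace d A : weight_le d A -> ((size (\tr A)).*2 <= d + 2)%N.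
Proof.
move=> wA; apply: (big_ind (fun q : {poly F} => (size q).*2 <= d + 2)%N).
- by rewrite size_poly0.
- by move=> q r; move: (size_polyD q r); set s := size _; lia.
- by move=> k _; move: (wA k k); move: (size _) => m; lia.
Qed.

(** The weight counts degrees in z only, uniformly over the powers of the marking variable. *)
Definition coef_weight_le d (P : {poly 'M[{poly F}]_2}) :=
  forall j, weight_le d P`_j.

Lemma coef_weight_leM d e P Q : coef_weight_le d P -> coef_weight_le e Q ->
  coef_weight_le (d + e) (P * Q).
Proof.
by move=> wP wQ j; rewrite coefM; apply: weight_le_sum => i; apply: weight_leM.
Qed.

Lemma coef_weight_leC d A : weight_le d A -> coef_weight_le d A%:P.
Proof. by move=> wA j; rewrite coefC; case: eqP => // _; apply: weight_le0. Qed.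

Lemma coef_weight_le_prod d (f : nat -> {poly 'M[{poly F}]_2}) r :
  (forall i, coef_weight_le d (f i)) ->
  coef_weight_le (size r * d) (\prod_(i <- r) f i).
Proof.
move=> w; elim: r => [|i r IH].
  rewrite big_nil mul0n; apply: coef_weight_leC; exact: weight_le1.
by rewrite big_cons mulSn; apply: coef_weight_leM.
Qed.
End Weight.

(** * Degree and leading-term bounds for the trace *)

Section TraceShift.
Variables (F : fieldType) (p : nat) (M : 'M[{poly F}]_2).
Hypothesis charFp : p \in [pchar F].
Hypothesis p_gt2 : (2 < p)%N.
Hypothesis wM : weight_le 3 M.
Let B (k : nat) := map_mx (comp_poly ('X + (k%:R)%:P)) M.
(** Keeping column 0 or 1 of [B k] forces the walk to be in that state at time k; [G k] marks state
    1 by X. *)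
Let U k := B k *m (delta_mx 0 0 : 'M_2).
Let V k := B k *m (delta_mx 1 1 : 'M_2).
Let G k : {poly 'M[{poly F}]_2} := (U k)%:P + (V k)%:P * 'X.
Let P := \prod_(i <- rev (iota 0 p)) G i.

Let UV k : U k + V k = B k.
Proof.
apply/matrixP => a b; rewrite mxE !mul_delta_diag; move: b.
by apply: ord2_case; rewrite ?mulr1 ?mulr0 ?addr0 ?add0r.
Qed.

Let B_shift k i :
  B (k + i) = map_mx (comp_poly ('X + (k%:R)%:P)) (B i).
Proof.
apply/matrixP => a b; rewrite !mxE -comp_polyA comp_polyD comp_polyX comp_polyC.
by rewrite natrD polyCD addrA.
Qed.

Let G_addp k : G (p + k) = G k.
Proof. by rewrite /G /U /V /B natrD (pcharf0 charFp) add0r. Qed.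

Let U_shift k i :
  U (k + i) = map_mx (comp_poly ('X + (k%:R)%:P)) (U i).
Proof. by rewrite /U B_shift map_mxM map_delta_mx. Qed.

Let V_shift k i :
  V (k + i) = map_mx (comp_poly ('X + (k%:R)%:P)) (V i).
Proof. by rewrite /V B_shift map_mxM map_delta_mx. Qed.

Let G_shift k i :
  G (k + i) = map_poly (map_mx (comp_poly ('X + (k%:R)%:P))) (G i).
Proof.
by rewrite /G rmorphD rmorphM /= map_polyX !map_polyC /= V_shift U_shift.
Qed.

Let wG i : coef_weight_le 3 (G i).
Proof.
have wB : weight_le 3 (B i) by apply: weight_le_shift.
have w a : weight_le 3 (B i *m delta_mx a a).
  by rewrite -[3%N]addn0; apply: weight_leM => //; apply: weight_le_delta.
move=> j; rewrite coefD coefMX; apply: weight_leD.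
  exact: coef_weight_leC (w 0) j.
by case: eqP => _; [apply: weight_le0 | apply: coef_weight_leC (w 1) _].
Qed.

(* The derivative in the marking variable multiplies the coefficient of index
   j by j, which is invertible. *)
Let size_mid j : (0 < j < p)%N -> (size (\tr P`_j) <= p)%N.
Proof.
case: j => // j /= jp.
(* The walks in state 1 at time 0 with j further visits to 1. *)
pose psi := \tr (\prod_(i <- rev (iota 1 p.-1)) G i * (V 0)%:P)`_j.
have szpsi : ((size psi).*2 <= p * 3 + 2)%N.
  apply: size_trace.
  have -> : (p * 3 = p.-1 * 3 + 3)%N by lia.
  apply: coef_weight_leM.
    by have := coef_weight_le_prod (rev (iota 1 p.-1)) wG; rewrite size_rev size_iota.
  apply: coef_weight_leC; rewrite -[3%N]addn0.
  by apply: weight_leM; [apply: weight_le_shift | apply: weight_le_delta].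
have nz : (j.+1%:R : F) != 0 by rewrite -(dvdn_pcharf charFp) gtnNdvd.
rewrite -(size_scale _ nz).
have -> : j.+1%:R *: \tr P`_j.+1 =
    \sum_(0 <= k < p) (psi \Po ('X + (k%:R)%:P)).
  rewrite scaler_nat -raddfMn /= -coef_deriv (deriv_prod_marked U V).
  rewrite coef_sum raddf_sum /=.
  (* Rotating the trace puts the marked factor last. With times read modulo p the other factors are
     those of times k + 1, ..., k + p - 1, so the term is psi shifted by k. *)
  apply: eq_big_nat => k /= kp; rewrite -/G mxtrace_coefMC mulrA.
  have -> : \prod_(i <- rev (iota 0 k)) G i =
      \prod_(i <- rev (iota (k.+1 + (p - k.+1)) k)) G i.
    rewrite subnKC // -[in RHS](addn0 p) iotaDl -map_rev big_map.
    by apply: eq_bigr => i _; rewrite G_addp.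
  rewrite -big_cat -revD_iota -[(V k)%:P]/((B k *m (delta_mx 1 1 : 'M_2))%:P).
  have -> : (p - k.+1 + k = p.-1)%N by lia.
  rewrite -(addn1 k) iotaDl -map_rev big_map.
  under eq_bigr do rewrite G_shift.
  rewrite -[in (V k)%:P](addn0 k) V_shift.
  rewrite -(map_polyC (map_mx _)) -rmorph_prod -rmorphM coef_map /=.
  by rewrite trace_map_mx.
(* The size is at most floor(3p/2) + 1 - (p - 1), which is at most p from p = 3 on but equals 3 for
   p = 2. *)
apply: leq_trans (size_sum_shift charFp psi) _; lia.
Qed.

Lemma size_trace_shift :
  (size (\tr (\prod_(k <- rev (iota 0 p)) B k) -
     (\prod_(k <- rev (iota 0 p)) B k 0 0 +
      \prod_(k <- rev (iota 0 p)) B k 1 1))%R <= p)%N.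
Proof.
have trU : \tr (\prod_(k <- rev (iota 0 p)) U k) = \prod_(k <- rev (iota 0 p)) B k 0 0.
  by case: p p_gt2 => // n _; apply: tr_prod_delta_diag.
have trV : \tr (\prod_(k <- rev (iota 0 p)) V k) = \prod_(k <- rev (iota 0 p)) B k 1 1.
  by case: p p_gt2 => // n _; apply: tr_prod_delta_diag.
rewrite -trU -trV -(coef0_prod_marked U V) -(coefn_prod_marked U V) -/P.
have -> : \prod_(k <- rev (iota 0 p)) B k = \sum_(j < p.+1) P`_j.
  by rewrite sum_coef_prod_marked; apply: eq_bigr => k _; rewrite UV.
rewrite -(big_mkord predT (fun j => P`_j)) big_nat_recr //= big_ltn; last by lia.
rewrite !mxtraceD.
set a := \tr P`_0; set b := \tr P`_p; set c := \tr _.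
have -> : a + c + b - (a + b) = c by ring.
rewrite /c raddf_sum /=; apply: leq_trans (size_sum _ _ _) _.
rewrite big_nat_cond; apply: (big_ind (fun n => n <= p)%N) => //.
  by move=> m n; rewrite geq_max => -> ->.
by move=> j; rewrite andbT; apply: size_mid.
Qed.
End TraceShift.

(** Bounding a difference, rather than naming a leading coefficient, lets [a] be zero. *)
Lemma size_prod_linear (F : fieldType) (a : F) (q : nat -> {poly F}) (r : seq nat) :
  (forall k, (size (q k - a *: 'X)%R <= 1)%N) ->
  (size (\prod_(k <- r) q k - a ^+ size r *: 'X^(size r))%R <= size r)%N.
Proof.
move=> hq; elim: r => [|k r IH].
  by rewrite big_nil expr0 scale1r expr0 subrr size_poly0.
rewrite big_cons /=; set n := size r in IH *; set Q := \prod_(_ <- _) _ in IH *.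
have -> : q k * Q - a ^+ n.+1 *: 'X^(n.+1) =
    q k * (Q - a ^+ n *: 'X^n) + (q k - a *: 'X) * (a ^+ n *: 'X^n).
  by rewrite -!mul_polyC !exprS polyCM; ring.
have sq : (size (q k) <= 2)%N.
  rewrite -(subrK (a *: 'X) (q k)); apply: leq_trans (size_polyD _ _) _.
  rewrite geq_max (leq_trans (hq k)) //; apply: leq_trans (size_scale_leq _ _) _.
  by rewrite size_polyX.
apply: leq_trans (size_polyD _ _) _; rewrite geq_max; apply/andP; split.
  by apply: leq_trans (size_polyMleq _ _) _; lia.
apply: leq_trans (size_polyMleq _ _) _.
have : (size (a ^+ n *: 'X^n : {poly F}) <= n.+1)%N.
  by apply: leq_trans (size_scale_leq _ _) _; rewrite size_polyXn.
by have := hq k; lia.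
Qed.

(** * T as a polynomial in z, and its closed form for odd p *)

Section ThetaPoly.
Variables (F : fieldType) (p : nat).
Hypothesis charFp : p \in [pchar F].
Variables x0 x1 x2 y0 y1 y2 : F.
Let t := x0 + x1 + x2.

Definition thetaX := theta p x0%:P x1%:P x2%:P ('X + y0%:P) ('X + y1%:P) ('X + y2%:P).

Lemma horner_thetaX c : thetaX.[c] = theta p x0 x1 x2 (c + y0) (c + y1) (c + y2).
Proof.
rewrite -[LHS]/(horner_eval c thetaX) theta_rmorph /= /horner_eval.
by rewrite !hornerD !hornerC hornerX.
Qed.

(** Three rotations return every x to its place and add 1 to every y. *)
Lemma thetaX_shift : thetaX \Po ('X + 1) = thetaX.
Proof.
have p0 : p%:R = 0 :> {poly F} by rewrite -polyC_natr (pcharf0 charFp).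
rewrite /thetaX [RHS](theta_rot p0) [RHS](theta_rot p0) [RHS](theta_rot p0).
rewrite theta_rmorph /= !comp_polyC !comp_polyD !comp_polyX !comp_polyC.
by congr (theta p _ _ _ _ _ _); rewrite addrAC.
Qed.

Let M := cell x0%:P x1%:P x2%:P ('X + y0%:P) ('X + y1%:P) ('X + y2%:P) 0.

Let wM : weight_le 3 M.
Proof.
have wL x y : weight_le 1 (lmx x%:P ('X + y%:P : {poly F})).
  have sx : (size x%:P <= 1)%N by apply: size_polyC_leq1.
  apply: ord2_case; apply: ord2_case;
    rewrite mxE /= ?size_poly0 ?size_poly1 ?size_XaddC //.
  by move: sx; move: (size _) => m; lia.
have -> : (3 = 1 + 1 + 1)%N by [].
rewrite /M /cell !addr0.
by do 2?apply: weight_leM.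
Qed.

Let cell_shift k :
  cell x0%:P x1%:P x2%:P ('X + y0%:P) ('X + y1%:P) ('X + y2%:P) k =
  map_mx (comp_poly ('X + (k%:R)%:P)) M.
Proof.
rewrite /M /cell !map_mxM /lmx !map_mx2 /= !addr0 !comp_polyD !comp_polyX !comp_polyC.
by rewrite !rmorph0 !rmorph1 !polyC_natr ![_ + _ + k%:R]addrAC.
Qed.

Lemma thetaX_odd : odd p -> thetaX = (t ^+ p) *: ('X^p - 'X) + (thetaX.[0])%:P.
Proof.
move=> op; have pr := pcharf_prime charFp; have p2 := odd_prime_gt2 op pr.
have sz : (size (thetaX - t ^+ p *: 'X^p)%R <= p)%N.
  have pn : [pchar F].-nat p by rewrite (eq_pnat _ (pcharf_eq charFp)) pnat_id.
  (* Frobenius splits t^p into the contributions of the two constant walks: B_00 and B_11 have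
     z-coefficients x0 + x2 and x1. *)
  have -> : t ^+ p = (x0 + x2) ^+ p + x1 ^+ p.
    by rewrite -exprDn_pchar // /t addrAC.
  have := size_trace_shift charFp p2 wM.
  have <- : thetaX =
      \tr (\prod_(k <- rev (iota 0 p)) map_mx (comp_poly ('X + (k%:R)%:P)) M).
    by rewrite /thetaX /theta; under eq_bigr do rewrite cell_shift.
  set u := \prod_(_ <- _) _; set v := \prod_(_ <- _) _ => h.
  have hu : (size (u - (x0 + x2) ^+ p *: 'X^p)%R <= p)%N.
    have {1 2 3}-> : p = size (rev (iota 0 p)) by rewrite size_rev size_iota.
    apply: size_prod_linear => k; rewrite -cell_shift.
    rewrite (_ : _ - _ = (x2 * x1 * x0 + x2 * (y0 + k%:R) + (y1 + k%:R) * x0)%:P).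
      exact: size_polyC_leq1.
    rewrite /cell /lmx !mx2_mul mxE /= -mul_polyC !(polyCD, polyCM) !polyC_natr; ring.
  have hv : (size (v - x1 ^+ p *: 'X^p)%R <= p)%N.
    have {1 2 3}-> : p = size (rev (iota 0 p)) by rewrite size_rev size_iota.
    apply: size_prod_linear => k; rewrite -cell_shift.
    rewrite (_ : _ - _ = (x1 * (y2 + k%:R))%:P); first exact: size_polyC_leq1.
    rewrite /cell /lmx !mx2_mul mxE /= -mul_polyC !(polyCD, polyCM) !polyC_natr; ring.
  have -> : thetaX - ((x0 + x2) ^+ p + x1 ^+ p) *: 'X^p =
     (thetaX - (u + v)) + ((u - (x0 + x2) ^+ p *: 'X^p) + (v - x1 ^+ p *: 'X^p)).
    by rewrite scalerDl; ring.
  do 2!(apply: leq_trans (size_polyD _ _) _; rewrite geq_max ?h ?hu ?hv //=).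
pose E := thetaX - t ^+ p *: ('X^p - 'X).
(* By Frobenius z^p - z is itself invariant under z -> z + 1. *)
have EX : E \Po ('X + 1) = E.
  rewrite /E comp_polyB comp_polyZ thetaX_shift comp_polyB comp_Xn_poly comp_polyX.
  congr (_ - _ *: _).
  have chX : p \in [pchar {poly F}] by rewrite pchar_poly.
  have pnX : [pchar {poly F}].-nat p by rewrite (eq_pnat _ (pcharf_eq chX)) pnat_id.
  by rewrite exprDn_pchar // expr1n opprD addrACA subrr addr0.
have sE : (size E <= p)%N.
  have -> : E = (thetaX - t ^+ p *: 'X^p) + t ^+ p *: 'X.
    by rewrite /E scalerBr opprB addrA addrAC.
  apply: leq_trans (size_polyD _ _) _; rewrite geq_max sz /=.
  apply: leq_trans (size_scale_leq _ _) _; rewrite size_polyX; lia.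
have := shift_invariant_const charFp EX sE.
rewrite /E !hornerE /= expr0n gtn_eqF ?prime_gt0 // !subr0 mulr0 subr0 => <-.
by rewrite addrC subrK.
Qed.
End ThetaPoly.

(** * Translation of z in both parities, and its effect on I_p *)

Section Translate.
Variables (F : fieldType) (p : nat).
Hypothesis charFp : p \in [pchar F].

Lemma theta_translate_odd (x0 x1 x2 y0 y1 y2 c : F) : odd p ->
  theta p x0 x1 x2 (c + y0) (c + y1) (c + y2) =
  theta p x0 x1 x2 y0 y1 y2 + (x0 + x1 + x2) ^+ p * (c ^+ p - c).
Proof.
move=> op; have := horner_thetaX p x0 x1 x2 y0 y1 y2 0; rewrite !add0r => <-.
rewrite -horner_thetaX (thetaX_odd charFp) // !hornerE /= expr0n.
by rewrite gtn_eqF ?prime_gt0 ?(pcharf_prime charFp) // subr0 mulr0 add0r addrC.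
Qed.

(** For p = 2 nonconstant walks also reach degree p: they contribute a monic cubic and its unit
    shift, whose sum has leading term z^2, the source of the 1 beside t^2. The identity is checked
    by expansion. *)
Lemma theta_translate_two (x0 x1 x2 y0 y1 y2 c : F) : p = 2%N ->
  theta p x0 x1 x2 (c + y0) (c + y1) (c + y2) =
  theta p x0 x1 x2 y0 y1 y2 + (1 + (x0 + x1 + x2) ^+ 2) * (c ^+ 2 - c).
Proof.
move=> p2; have two0 : 2%:R = 0 :> F by rewrite -p2 (pcharf0 charFp).
rewrite p2 /theta [rev _]/= !big_cons !big_nil !mulr1 /cell /lmx !mx2_mul !mx2_tr.
pose s := x0 + x1 + x2.
(* K is half of the difference of the two sides, which has even coefficients
   over the integers. *)
pose K := c * (x0 * x1 * x2 * s + s ^+ 2 + (x2 * y0 + x0 * y1 + x1 * y2) * s +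
  (c + 1) * (c + y0 + y1 + y2) + (y0 * y1 + y1 * y2 + y0 * y2) + 1).
apply: subr0_eq; transitivity (2%:R * K); last by rewrite two0 mul0r.
rewrite /K /s; ring.
Qed.
End Translate.

(** Common to both parities, with d standing for t^p or 1 + t^2. *)
Lemma Iexpr_transforms (F : fieldType) p (f g a1 a2 t d : F) :
  p \in [pchar F] -> f != 0 -> g != 0 -> f - g + t != 0 ->
  (forall c, theta p (- f) g (f - g + t) (c + 0) (c + a2) (c + (1 - a1)) =
     theta p (- f) g (f - g + t) 0 a2 (1 - a1) + d * (c ^+ p - c)) ->
  [/\ Iexpr p (f + (a1 + a2 - 1) / (f - g + t))
        (g + (a1 + a2 - 1) / (f - g + t)) (1 - a2) (1 - a1) t =
        Iexpr p f g a1 a2 t,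
      Iexpr p f (g - a1 / f) (- a1) (a1 + a2) t =
        Iexpr p f g a1 a2 t + d * (a1 ^+ p - a1),
      Iexpr p (f + a2 / g) g (a1 + a2) (- a2) t =
        Iexpr p f g a1 a2 t - d * (a2 ^+ p - a2)
    & Iexpr p (- g) (f - g + t) a2 (1 - a1 - a2) t =
        Iexpr p f g a1 a2 t - d * (a2 ^+ p - a2)].
Proof.
move=> chp f0 g0 h0 Td; have p0 := pcharf0 chp.
(* The value T(-a2), shared by s_2 and pi; the sign comes out since (-a2)^p = -a2^p in
   characteristic p, also for p = 2. *)
have TN : theta p (- f) g (f - g + t) (- a2) (- a2 + a2) (- a2 + (1 - a1)) =
    Iexpr p f g a1 a2 t - d * (a2 ^+ p - a2).
  rewrite -{1}[- a2]addr0 Td -Iexpr_theta // exprNn_pchar.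
    by rewrite -opprD mulrN.
  by rewrite (eq_pnat _ (pcharf_eq chp)) pnat_id // (pcharf_prime chp).
split.
- by rewrite Iexpr_s0 // -Iexpr_theta.
- by rewrite Iexpr_s1 // Iexpr_theta // -Td addr0 [a1 + a2]addrC.
- by rewrite Iexpr_s2.
- by rewrite Iexpr_pi.
Qed.

(** * Nonzero denominators in the function field, and the conclusion *)

Section RationalFunctions.
Variable k : fieldType.

Lemma rvar_neq0 i : rvar k i != 0.
Proof.
rewrite tofrac_eq0; apply/eqP => /(congr1 (mcoeff U_(i))).
by rewrite mcoeffXU eqxx mcoeff0 => /eqP; rewrite oner_eq0.
Qed.

Lemma vf_vg_vt_neq0 : vf k - vg k + vt k != 0.
Proof.
rewrite -tofracB -tofracD tofrac_eq0; apply/eqP => /(congr1 (mcoeff U_(0))).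
rewrite mcoeffD mcoeffB !mcoeffXU mcoeff0 /= subr0 addr0 => /eqP.
by rewrite oner_eq0.
Qed.
End RationalFunctions.

Theorem theorem3p6 (k : fieldType) (p : nat) (pr_p : prime p)
    (chk : p \in [pchar k]) :
  let a1 := va1 k in let a2 := va2 k in
  let t := vt k in
  (odd p ->
     [/\ s0I k p = Ip k p,
         s1I k p = Ip k p + t ^+ p * (a1 ^+ p - a1),
         s2I k p = Ip k p - t ^+ p * (a2 ^+ p - a2)
       & piI k p = Ip k p - t ^+ p * (a2 ^+ p - a2)]) /\
  (p = 2%N ->
     [/\ s0I k p = Ip k p,
         s1I k p = Ip k p + (1 + t ^+ 2) * (a1 ^+ 2 - a1),
         s2I k p = Ip k p - (1 + t ^+ 2) * (a2 ^+ 2 - a2)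
       & piI k p = Ip k p - (1 + t ^+ 2) * (a2 ^+ 2 - a2)]).
Proof.
move=> a1 a2 t.
have chp : p \in [pchar RF k].
  apply: (rmorph_pchar (@tofrac {mpoly k[5]})).
  exact: (rmorph_pchar (@mpolyC 5 k)).
have f0 := rvar_neq0 k 0; have g0 := rvar_neq0 k 1; have h0 := vf_vg_vt_neq0 k.
have sumx : - vf k + vg k + (vf k - vg k + vt k) = t by rewrite /t; ring.
split=> [op|p2].
  apply: (Iexpr_transforms chp f0 g0 h0) => c.
  by rewrite (theta_translate_odd chp) // sumx.
move: chp; rewrite p2 => ch2; apply: (Iexpr_transforms ch2 f0 g0 h0) => c.
by rewrite (theta_translate_two ch2) // sumx.
Qed.
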